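(* Let $(H_n)_{n\in\mathbb N}$ be a sequence of Hilbert spaces and, for each $n\in\mathbb N$, let $\mathcal T_n=(T_n(t))_{t\ge0}\subset\mathcal L(H_n)$ be a weakly measurable semigroup such that $\bigotimes_{n\in\mathbb N}\mathcal T_n\subset\mathcal L\bigl(\bigotimes_{n\in\mathbb N}H_n\bigr)$ (complete tensor product) is a nonzero semigroup. Then $\bigotimes_{n\in\mathbb N}\mathcal T_n$ is weakly measurable.
   Context: Hilbert spaces are complex; $\mathcal L(H)$ denotes the bounded operators on $H$. A semigroup is a family $\mathcal T=(T(t))_{t\ge0}\subset\mathcal L(H)$ with $T(0)=I$ and $T(s+t)=T(s)T(t)$. It is nonzero if $T(t)\ne0$ for some $t>0$, and weakly measurable if $t\mapsto\langle T(t)h,g\rangle$ is Lebesgue measurable for all $h,g\in H$. Products: for $(z_n)\subset\mathbb C$, $\prod_nz_n$ converges unconditionally to $a\in\mathbb C$ if $\lim_{N\to\infty}\prod_{n=1}^Nz_{\sigma(n)}=a$ for every bijection $\sigma:\mathbb N\to\mathbb N$. $\prod_nz_n$ is quasi-convergent if $\prod_n|z_n|$ converges unconditionally to a finite value; its value is then the unconditional limit of $\prod_nz_n$ if it exists and $0$ otherwise. Complete tensor products: $(h_n)\in\times_nH_n$ is a $C$-sequence if $\prod_n\|h_n\|$ converges unconditionally to a finite value. For a $C$-sequence $(h_n)$ the elementary tensor $\bigotimes_nh_n$ is the functional $(f_n)\mapsto\prod_n\langle h_n,f_n\rangle$ (quasi-convergent product) on the set of $C$-sequences. The complete tensor product $\bigotimes_nH_n$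 is the completion of the linear span of elementary tensors with inner product determined by $\langle\bigotimes_nh_n,\bigotimes_nf_n\rangle=\prod_n\langle h_n,f_n\rangle$. For $A_n\in\mathcal L(H_n)$, $\bigotimes_nA_n$ is well-defined if for every elementary tensor $\bigotimes_nh_n$ also $\bigotimes_nA_nh_n$ is an elementary tensor and $\bigotimes_nh_n\mapsto\bigotimes_nA_nh_n$ extends linearly to a bounded operator on $\bigotimes_nH_n$. $\bigotimes_n\mathcal T_n:=(\bigotimes_nT_n(t))_{t\ge0}$; saying it is a semigroup includes that these operators are well-defined for all $t\ge0$. *)

(* Defs.v *)
From HB Require Import structures.
From mathcomp Require Import all_boot all_order all_algebra.
From mathcomp Require Import sesquilinear complex.
From mathcomp Require Import all_classical all_reals all_analysis.
From mathcomp Require Import measurable_realfun.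

Set Implicit Arguments.
Unset Strict Implicit.
Unset Printing Implicit Defensive.

Import Order.TTheory GRing.Theory Num.Theory.
Import numFieldNormedType.Exports.

Local Open Scope classical_set_scope.
Local Open Scope ring_scope.

(* The topology and norm of R[i] as a module over itself. *)
HB.instance Definition _ (R : realType) := NormedModule.copy R[i] R[i]^o.

(* The inner product is linear in its first argument (convention of {dot _}). *)
HB.mixin Record isHilbert (R : realType) V of CompleteNormedModule R[i] V := {
  dotp : {dot V for Num.conj};
  normr_dotp : forall x : V, `|x| ^+ 2 = dotp x x
}.

#[short(type="hilbertType")]
HB.structure Definition Hilbert (R : realType) :=
  {V of CompleteNormedModule R[i] V & isHilbert R V}.

(* [measurable] on R itself is the Borel sigma-algebra; this type carries the
   completion of it with respect to the Lebesgue measure. *)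
Definition lebesgueType (R : realType) : Type :=
  g_sigma_algebraType (completed_algebra_gen (@lebesgue_measure R)).
HB.instance Definition _ (R : realType) := Measurable.on (lebesgueType R).

Definition lebesgue_measurable (R : realType) (D : set R) (f : R -> R[i]) : Prop :=
  measurable_fun (D : set (lebesgueType R))
    (fun t : lebesgueType R => complex.Re (f t)) /\
  measurable_fun (D : set (lebesgueType R))
    (fun t : lebesgueType R => complex.Im (f t)).

Section semigroups.
Context {R : realType} {V : hilbertType R}.
Implicit Types T : R -> {linear V -> V}.

Definition bounded_op (A : {linear V -> V}) : Prop :=
  bounded_near A (nbhs (0 : V)).

(* A family (T t)_{t >= 0} is a total function on R whose values at t < 0 are
   irrelevant; all the predicates below look at t >= 0 only. *)
Definition semigroup T : Prop :=
  [/\ forall t, 0 <= t -> bounded_op (T t),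
      forall x, T 0 x = x
    & forall s t, 0 <= s -> 0 <= t -> forall x, T (s + t) x = T s (T t x)].

Definition nonzero_family T : Prop :=
  exists2 t, 0 < t & exists x, T t x != 0.

Definition weakly_measurable T : Prop :=
  forall h g : V, lebesgue_measurable [set t | 0 <= t] (fun t => dotp (T t h) g).

End semigroups.

Section products.
Context {R : realType}.
Implicit Types (z : nat -> R[i]) (a : R[i]).

Definition uncond_prod z a : Prop :=
  forall s : nat -> nat, bijective s ->
    (fun N : nat => \prod_(n < N) z (s n)) @ \oo --> a.

(* The value of a quasi-convergent product: its unconditional limit if there
   is one, and 0 otherwise. *)
Definition qprod z : R[i] := xget 0 [set a | uncond_prod z a].

End products.

Section complete_tensor.
Context {R : realType}.
Variable H : nat -> hilbertType R.

Record Cseq := MkCseq {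
  cseq :> forall n, H n;
  cseqP : exists a : R[i], uncond_prod (fun n => `|cseq n|) a }.

Definition elementary_tensor (h : Cseq) : Cseq -> R[i] :=
  fun f => qprod (fun n => dotp (h n) (f n)).

Definition tensor_span : set (Cseq -> R[i]) :=
  [set F | exists m (c : 'I_m -> R[i]) (h : 'I_m -> Cseq),
     F = fun f => \sum_(i < m) c i * elementary_tensor (h i) f].

(* A completion of the linear span of the elementary tensors: a Hilbert space
   with a linear isometric embedding of the span onto a dense subspace. It is
   unique up to a unitary that respects the embeddings. The values of [ct_emb]
   outside of [tensor_span] are irrelevant. *)
Record completeTensor := CompleteTensor {
  ct_space :> hilbertType R;
  ct_emb : (Cseq -> R[i]) -> ct_space;
  ct_linear : forall (a : R[i]) F G, tensor_span F -> tensor_span G ->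
    ct_emb (fun f => a * F f + G f) = a *: ct_emb F + ct_emb G;
  ct_dotp : forall h f : Cseq,
    dotp (ct_emb (elementary_tensor h)) (ct_emb (elementary_tensor f)) =
    qprod (fun n => dotp (h n) (f n));
  ct_dense : dense (ct_emb @` tensor_span) }.

(* B is the operator \bigotimes_n A_n (which is in particular well-defined).
   B is determined by A, since the elementary tensors are total in K. *)
Definition is_tensor_op (K : completeTensor)
    (A : forall n, {linear H n -> H n}) (B : {linear K -> K}) : Prop :=
  bounded_op B /\
  forall h : Cseq, exists2 g : Cseq, forall n, g n = A n (h n) &
    B (ct_emb K (elementary_tensor h)) = ct_emb K (elementary_tensor g).

End complete_tensor.

(* Main.v *)
Require Import Defs.
From mathcomp Require Import all_boot all_order all_algebra.
From mathcomp Require Import sesquilinear complex.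
From mathcomp Require Import all_classical all_reals all_analysis.
From mathcomp Require Import measurable_realfun ring zify.

Set Implicit Arguments.
Unset Strict Implicit.
Unset Printing Implicit Defensive.

Import Order.TTheory GRing.Theory Num.Theory.
Import numFieldNormedType.Exports.

Local Open Scope classical_set_scope.
Local Open Scope ring_scope.

(** Why the theorem is true.

    Everything rests on one fact about infinite products: if every
    [t |-> z n t] is measurable, then so is [t |-> qprod (z ^~ t)]
    ([cmeasurable_qprod]).  This is not immediate, because [qprod] is defined
    through all bijections of [nat], an uncountable family of conditions, and
    jumps to the default value 0 when the unconditional limit does not exist.
    The way around it is a Cauchy criterion, [prod_cauchy]: for every [e > 0]
    there is an [N] such that the product of [z] over any finite set of indices
    [>= N] is within [e] of 1.  It quantifies over countable sets only (integers
    and finite sets of integers, [e] being taken of the form [1/(k+1)]), so the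
    set of [t] at which it holds is measurable.  And it decides the value:

    - if [prod_cauchy z] holds, the product converges unconditionally, so that
      [qprod z] is the limit of the partial products in their usual order;
    - if it fails, no nonzero number is an unconditional limit, so that
      [qprod z = 0] whether as a limit or by default.

    For the second point, a failure of the criterion yields infinitely many
    disjoint finite blocks over which the product stays [e]-away from 1; a
    bijection that runs through those blocks one after another has partial
    products that keep changing by a factor away from 1, which is incompatible
    with a nonzero limit.  Thus [qprod (z ^~ t)] is the pointwise limit of the
    partial products multiplied by the indicator of a measurable set
    ([qprod_cvg]).

    The matrix coefficient of the tensor product operator between two
    elementary tensors is such a [qprod], with [z n t = <T_n(t) h_n, f_n>].
    Sesquilinearity extends measurability to the span of the elementary
    tensors.  Any two vectors are limits of sequences in that span, and for each
    fixed [t >= 0] the coefficients converge along these sequences, since the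
    operator is bounded and the inner product is jointly continuous; a pointwise
    limit of measurable functions is measurable. *)

(** * Bijections of the integers running through prescribed blocks *)

(** If blocks with property [P] occur arbitrarily far out, then some bijection
    of [nat] enumerates such blocks, each in one uninterrupted run, again and
    again.  The bijection is built by exhausting consecutive intervals: inside
    an interval starting at [m], the block [F m] is listed first and the
    remaining integers of the interval after it. *)
Lemma bijection_through_blocks (P : seq nat -> Prop) :
  (forall N, exists F, [/\ uniq F, all (leq N) F & P F]) ->
  exists2 s : nat -> nat, bijective s &
    forall k, exists m F, [/\ (k <= m)%N, P F & map s (iota m (size F)) = F].
Proof.
move=> /choice[F FP].
(* The interval after [m] must be long enough to contain the block [F m];
   the successor also makes it nonempty, so that every integer is reached. *)
pose width m := (\max_(i <- F m) i).+1.
pose rest m := [seq i <- iota m (width m) | i \notin F m].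
pose fix L k := if k is k'.+1 then
  L k' ++ F (size (L k')) ++ rest (size (L k')) else [::].
have permFR m : perm_eq (F m ++ rest m) (iota m (width m)).
  have [uF geF _] := FP m.
  apply: uniq_perm => [||i]; last 2 first.
  - exact: iota_uniq.
  - rewrite mem_cat mem_filter mem_iota; case: (boolP (i \in F m)) => //= iF.
    rewrite (allP geF _ iF) /= /width addnS ltnS.
    by rewrite (leq_trans _ (leq_addl _ _)) //
      (@leq_bigmax_seq _ (F m) xpredT (fun j : nat => j) i).
  rewrite cat_uniq uF filter_uniq ?iota_uniq // andbT /=.
  by apply/hasPn => i; rewrite mem_filter => /andP[].
have permL k : perm_eq (L k) (iota 0 (size (L k))).
  elim: k => //= k IH; set m := size (L k).
  rewrite size_cat iotaD add0n perm_cat //.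
  by rewrite (perm_size (permFR m)) size_iota.
have sizeL k : (k <= size (L k))%N.
  elim: k => //= k IH; rewrite size_cat (perm_size (permFR _)) size_iota.
  by rewrite /width; lia.
have prefL j k : (j <= k)%N -> exists t, L k = L j ++ t.
  move/subnK <-; elim: (k - j)%N => [|i [t IH]].
    by exists [::]; rewrite cats0.
  by rewrite addSn /= IH; eexists; rewrite -catA.
(* [L n.+1] has more than [n] entries, and the lists [L k] are prefixes of one
   another, so the default value of [nth] never occurs. *)
pose s n := nth 0%N (L n.+1) n.
have nthL k n : (n < size (L k))%N -> nth 0%N (L k) n = s n.
  move=> nk; have nn := sizeL n.+1; rewrite /s.
  case: (leqP k n.+1) => kn.
    by have [t ->] := prefL _ _ kn; rewrite nth_cat nk.
  by have [t ->] := prefL _ _ (ltnW kn); rewrite nth_cat nn.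
have uL k : uniq (L k) by rewrite (perm_uniq (permL k)) iota_uniq.
have memL k i : (i \in L k) = (i < size (L k))%N.
  by rewrite (perm_mem (permL k)) mem_iota.
exists s.
  exists (fun i => index i (L i.+1)) => [n|i].
    set i := s n; pose k := maxn n.+1 i.+1.
    have nk : (n < size (L k))%N by rewrite (leq_trans _ (sizeL _)) // leq_maxl.
    have [t Lk] := prefL i.+1 k (leq_maxr _ _).
    have iL : i \in L i.+1 by rewrite memL; exact: sizeL.
    have -> : index i (L i.+1) = index i (L k) by rewrite Lk index_cat iL.
    by rewrite /i -(nthL k n nk) index_uniq.
  have iL : i \in L i.+1 by rewrite memL; exact: sizeL.
  by rewrite -(nthL i.+1) ?index_mem // nth_index.
move=> k; pose m := size (L k); exists m, (F m); split=> //.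
  by have [] := FP m.
apply: (@eq_from_nth _ 0%N); rewrite ?size_map ?size_iota // => i iF.
rewrite (nth_map 0%N) ?size_iota // nth_iota // -(nthL k.+1) /= -/m; last first.
  by rewrite !size_cat -/m ltn_add2l ltn_addr.
by rewrite nth_cat ltnNge leq_addr /= addKn nth_cat iF.
Qed.

(** * Convergence of complex sequences *)

Section UnconditionalProducts.
Context {R : realType}.
Implicit Types (z u : nat -> R[i]) (a : R[i]).

Lemma invSn_ltc (e : R[i]) : 0 < e -> exists k : nat, k.+1%:R^-1 < e.
Proof.
move=> e0; have eE : e = (complex.Re e)%:C%C.
  by rewrite RRe_real // gtr0_real.
move: e0; rewrite eE ltcR => e0.
have [k _ /(_ k (leqnn k))] := near_infty_natSinv_lt (PosNum e0).
move=> /= ke; exists k.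
have -> : (k.+1%:R^-1 : R[i]) = (k.+1%:R^-1)%:C%C by rewrite fmorphV rmorph_nat.
by rewrite ltcR.
Qed.

Lemma normc_ge_Re (z : R[i]) : (`|complex.Re z|)%:C%C <= `|z|.
Proof.
rewrite normc_def lecR -sqrtr_sqr ler_sqrt ?lerDl ?sqr_ge0 //.
by rewrite addr_ge0 ?sqr_ge0.
Qed.

Lemma normc_ge_Im (z : R[i]) : (`|complex.Im z|)%:C%C <= `|z|.
Proof.
rewrite normc_def lecR -sqrtr_sqr ler_sqrt ?lerDr ?sqr_ge0 //.
by rewrite addr_ge0 ?sqr_ge0.
Qed.

Lemma cvgc_Re u a : u @ \oo --> a ->
  (fun n => complex.Re (u n)) @ \oo --> complex.Re a.
Proof.
move=> /cvgrPdist_lt ua; apply/cvgrPdist_lt => e e0.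
have := ua e%:C%C; rewrite ltcR => /(_ e0); apply: filterS => n.
move=> /(le_lt_trans (normc_ge_Re _)); rewrite ltcR.
by move: (u n) a {ua} => [? ?] [? ?].
Qed.

Lemma cvgc_Im u a : u @ \oo --> a ->
  (fun n => complex.Im (u n)) @ \oo --> complex.Im a.
Proof.
move=> /cvgrPdist_lt ua; apply/cvgrPdist_lt => e e0.
have := ua e%:C%C; rewrite ltcR => /(_ e0); apply: filterS => n.
move=> /(le_lt_trans (normc_ge_Im _)); rewrite ltcR.
by move: (u n) a {ua} => [? ?] [? ?].
Qed.

Lemma cvgc_ReIm u a : (fun n => complex.Re (u n)) @ \oo --> complex.Re a ->
  (fun n => complex.Im (u n)) @ \oo --> complex.Im a -> u @ \oo --> a.
Proof.
move=> /cvgrPdist_lt re /cvgrPdist_lt im; apply/cvgrPdist_lt => e e0.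
have eE : e = (complex.Re e)%:C%C by rewrite RRe_real // gtr0_real.
move: e0; rewrite eE ltcR => e0.
have e2 : 0 < complex.Re e / 2 by rewrite divr_gt0.
move: (re _ e2) (im _ e2); apply: filterS2 => n ren imn.
have -> : a - u n = (complex.Re a - complex.Re (u n))%:C%C
    + 'i%C * (complex.Im a - complex.Im (u n))%:C%C.
  by move: (u n) a {re im ren imn} => [? ?] [? ?]; simpc;
    congr (_ +i* _)%C; ring.
rewrite (le_lt_trans (ler_normD _ _)) // normrM.
rewrite !normc_def /= !(expr0n, addr0, add0r, expr1n) !sqrtr_sqr sqrtr1 mul1r.
rewrite -rmorphD ltcR (splitr (complex.Re e)) ltrD //.
Qed.

Lemma cvgc_cauchy u :
  (forall e, 0 < e -> exists N, forall M, (N <= M)%N -> `|u M - u N| < e) ->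
  exists a, u @ \oo --> a.
Proof.
move=> uC.
have real_cvg (f : R[i] -> R) : (forall x y, (`|f x - f y|)%:C%C <= `|x - y|) ->
    exists b : R, (f \o u) @ \oo --> b.
  move=> fP; suff fu : cvg ((f \o u) @ \oo) by exists (lim ((f \o u) @ \oo)).
  apply/cauchy_cvgP/cauchy_exP => e e0.
  have [|N uN] := uC e%:C%C; first by rewrite ltcR.
  exists (f (u N)), N => // M /= /uN uM.
  by rewrite -ball_normE /= distrC -ltcR; apply: le_lt_trans uM.
have [|b ub] := real_cvg (@complex.Re R).
  by move=> x y; apply: le_trans (normc_ge_Re _); case: x y => [? ?] [? ?].
have [|c uc] := real_cvg (@complex.Im R).
  by move=> x y; apply: le_trans (normc_ge_Im _); case: x y => [? ?] [? ?].
by exists (b +i* c)%C; exact: cvgc_ReIm.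
Qed.

(** * The Cauchy criterion for unconditional products *)

(** The duplicate-free lists [s] stand for finite sets of indices: [seq nat] is
    a countable type, which is what makes the criterion measurable. *)
Definition prod_cauchy z : Prop :=
  forall e : R[i], 0 < e -> exists N, forall s : seq nat,
    uniq s -> all (leq N) s -> `|\prod_(i <- s) z i - 1| < e.

(** A duplicate-free list containing [0, ..., N-1] is a rearrangement of it
    followed by indices [>= N]; so its product is that of the first [N] factors
    times a number close to 1.  The partial products being bounded, the relative
    error becomes an absolute one. *)
Lemma prod_cauchy_superset z : prod_cauchy z ->
  forall e : R[i], 0 < e -> exists N, forall s : seq nat,
    uniq s -> {subset iota 0 N <= s} ->
    `|\prod_(i <- s) z i - \prod_(0 <= i < N) z i| < e.
Proof.
move=> zC e e0; have [N0 zN0] := zC 1 ltr01.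
pose P n := \prod_(0 <= i < n) z i.
(* A strict bound for all partial products from [N0] on, where the product over
   the indices [>= N0] has modulus at most 2; adding 1 keeps it positive. *)
pose b := 2 * `|P N0| + 1.
have b0 : 0 < b by rewrite ltr_wpDl // mulr_ge0.
have [N1 zN1] := zC (e / b) (divr_gt0 e0 b0).
pose N := maxn N0 N1; exists N => s us sN.
have PNb : `|P N| < b.
  have -> : P N = P N0 * \prod_(i <- iota N0 (N - N0)) z i.
    by rewrite /P (@big_cat_nat _ _ _ N0) ?leq_maxl.
  rewrite normrM.
  have : `|\prod_(i <- iota N0 (N - N0)) z i| <= 2.
    rewrite -[X in `|X|](subrK 1) (le_trans (ler_normD _ _)) // normr1.
    rewrite (_ : 2 = 1 + 1) // lerD2r ltW // zN0 ?iota_uniq //.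
    by apply/allP => i; rewrite mem_iota => /andP[].
  move=> /(ler_wpM2l (normr_ge0 (P N0))) /le_lt_trans; apply.
  by rewrite mulrC ltrDl.
have sE : perm_eq s (iota 0 N ++ [seq i <- s | (N <= i)%N]).
  rewrite -(perm_filterC (fun i => (N <= i)%N)) perm_catC perm_cat2r.
  apply: uniq_perm => [||i]; rewrite ?filter_uniq ?iota_uniq //.
  rewrite mem_filter /= -ltnNge mem_iota /=.
  by case: ltnP => //= iN; apply: sN; rewrite mem_iota.
rewrite (perm_big _ sE) big_cat /=.
have -> : \prod_(i <- iota 0 N) z i = P N.
  by rewrite /P /index_iota subn0.
rewrite -/(P N) -[X in _ - X]mulr1 -mulrBr normrM.
have : `|\prod_(i <- [seq i <- s | (N <= i)%N]) z i - 1| < e / b.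
  apply: zN1; first exact: filter_uniq.
  apply/allP => i; rewrite mem_filter => /andP[Ni _].
  by rewrite (leq_trans (leq_maxr N0 N1)).
move=> zs; rewrite -[e](divfK (lt0r_neq0 b0)) mulrC.
by rewrite ltr_pM.
Qed.

(** The first [M] values of a bijection contain [0, ..., N-1] as soon as [M] is
    large, so that all rearranged partial products are eventually close to the
    same number. *)
Lemma uncond_prod_cauchy z : prod_cauchy z -> exists a, uncond_prod z a.
Proof.
move=> zC; have zS := prod_cauchy_superset zC.
have [a za] : exists a : R[i], (fun N => \prod_(0 <= i < N) z i) @ \oo --> a.
  apply: cvgc_cauchy => e e0; have [N zN] := zS e e0; exists N => M NM.
  apply: zN; rewrite /index_iota ?iota_uniq // => i.
  by rewrite subn0 !mem_iota => /= /leq_trans; apply.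
exists a => s [g sK gK]; apply/cvgrPdist_lt => e e0.
have e2 : 0 < e / 2 by rewrite divr_gt0.
have e4 : 0 < e / 2 / 2 by rewrite divr_gt0.
have [N zN] := zS _ e4.
have : \forall M \near \oo, `|a - \prod_(0 <= i < M) z i| < e / 2.
  by move/cvgrPdist_lt : za; apply.
apply: filterS2 (nbhs_infty_ge (maxn N (\max_(i < N) (g i).+1))) => M MN aM.
rewrite geq_max in MN; have /andP[NM gM] := MN.
have -> : \prod_(n < M) z (s n) = \prod_(i <- map s (iota 0 M)) z i.
  by rewrite big_map -(big_mkord xpredT (fun n => z (s n))) /index_iota subn0.
have sM : `|\prod_(i <- map s (iota 0 M)) z i - \prod_(0 <= i < N) z i|
    < e / 2 / 2.
  apply: zN; first by rewrite map_inj_uniq ?iota_uniq //; exact: can_inj sK.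
  move=> i; rewrite mem_iota /= => iN; apply/mapP; exists (g i) => //.
  rewrite mem_iota /=; apply: leq_trans gM.
  exact: (leq_bigmax (F := fun i : 'I_N => (g i).+1) (Ordinal iN)).
have idM : `|\prod_(0 <= i < M) z i - \prod_(0 <= i < N) z i| < e / 2 / 2.
  apply: zN; rewrite /index_iota ?iota_uniq // => i.
  by rewrite subn0 !mem_iota => /= /leq_trans; apply.
rewrite (splitr e) (le_lt_trans (ler_distD (\prod_(0 <= i < M) z i) _ _)) //.
rewrite ltrD // (splitr (e / 2)).
rewrite (le_lt_trans (ler_distD (\prod_(0 <= i < N) z i) _ _)) //.
by rewrite ltrD // distrC.
Qed.

(** A limit [a != 0] keeps the partial products [Q] away from 0, so running
    through a block with product far from 1 changes [Q] by a definite amount,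
    infinitely often. *)
Lemma prod_cauchy_uncond z a : a != 0 -> uncond_prod z a -> prod_cauchy z.
Proof.
move=> a0 za; apply: contrapT => nC.
have {nC}[e [e0 nC]] : exists e : R[i], 0 < e /\ forall N, exists s : seq nat,
    [/\ uniq s, all (leq N) s & e <= `|\prod_(i <- s) z i - 1|].
  apply: contrapT => nE; apply: nC => e e0; apply: contrapT => nN.
  apply: nE; exists e; split=> // N; apply: contrapT => ns; apply: nN.
  exists N => s us sN.
  have er : (e \is Num.real) by rewrite gtr0_real.
  by rewrite real_ltNge ?normr_real //; apply/negP => le; apply: ns; exists s.
have [s sbij sF] := bijection_through_blocks nC.
have a2 : 0 < `|a| / 2 by rewrite divr_gt0 ?normr_gt0.
have d0 : 0 < `|a| / 2 * e / 2 by rewrite divr_gt0 // mulr_gt0.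
pose Q n := \prod_(0 <= i < n) z (s i).
have Qa (d : R[i]) : 0 < d -> exists N, forall n, (N <= n)%N -> `|a - Q n| < d.
  move=> dgt0; have /cvgrPdist_lt /(_ d dgt0)[N _ NQ] := za s sbij.
  by exists N => n /NQ /=; rewrite /Q big_mkord.
have [N1 Q1] := Qa _ a2; have [N2 Q2] := Qa _ d0.
have [m [F [mN eF FE]]] := sF (maxn N1 N2).
rewrite geq_max in mN; have /andP[mN1 mN2] := mN.
have Qm : Q (m + size F)%N - Q m = Q m * (\prod_(i <- F) z i - 1).
  rewrite -{2}FE big_map mulrBr mulr1 /Q (@big_cat_nat _ _ _ m) ?leq_addr //=.
  by rewrite /index_iota addKn.
have Qlo : `|a| / 2 < `|Q m|.
  have := Q1 _ mN1; rewrite -(ltrD2r `|Q m|) => h.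
  have : `|a| <= `|a - Q m| + `|Q m|.
    by rewrite -{1}(subrK (Q m) a) ler_normD.
  move=> /le_lt_trans /(_ h); rewrite {1}(splitr `|a|).
  by rewrite ltrD2l.
have : `|a| / 2 * e < `|a| / 2 * e.
  apply: (@le_lt_trans _ _ `|Q (m + size F)%N - Q m|).
    by rewrite Qm normrM ler_pM // ltW.
  rewrite (splitr (_ * e)) (le_lt_trans (ler_distD a _ _)) // ltrD //.
    by rewrite distrC Q2 // (leq_trans mN2) // leq_addr.
  exact: Q2.
by rewrite ltxx.
Qed.

(** The criterion only involves countably many conditions, and the limit below
    is sequential: this is the form of [qprod] that shows its measurability. *)
Lemma qprod_cvg z :
  (fun N => (if `[< prod_cauchy z >] then \prod_(0 <= i < N) z i else 0))
    @ \oo --> qprod z.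
Proof.
have idP a : uncond_prod z a -> (fun N => \prod_(0 <= i < N) z i) @ \oo --> a.
  move=> /(_ id) za; under eq_fun do rewrite big_mkord.
  by apply: za; exists id.
case: asboolP => [zC|nC].
  exact/idP/(xgetPex 0 (uncond_prod_cauchy zC)).
suff -> : qprod z = 0 by exact: cvg_cst.
rewrite /qprod; case: xgetP => // a _ za.
by apply/eqP; apply: contrapT => /negP a0; exact: nC (prod_cauchy_uncond a0 za).
Qed.

End UnconditionalProducts.

(** * Measurable complex functions *)

Section ComplexMeasurable.
Context d (T : measurableType d) (R : realType) (D : set T).
Implicit Types f g : T -> R[i].

(** Over [lebesgueType R], this is [lebesgue_measurable] up to conversion. *)
Definition cmeasurable f : Prop :=
  measurable_fun D (fun t => complex.Re (f t)) /\
  measurable_fun D (fun t => complex.Im (f t)).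

(** [measurable_fun D] is an implication from the measurability of [D], which is
    therefore available when one proves it. *)
Lemma cmeasurable_dom f : (measurable D -> cmeasurable f) -> cmeasurable f.
Proof. by move=> mf; split=> mD; have [re im] := mf mD; auto. Qed.

Lemma eq_cmeasurable f g : (forall t, D t -> f t = g t) ->
  cmeasurable f -> cmeasurable g.
Proof.
move=> fg [re im]; split.
  by apply: eq_measurable_fun re => t /set_mem /fg ->.
by apply: eq_measurable_fun im => t /set_mem /fg ->.
Qed.

Lemma cmeasurable_cst c : cmeasurable (fun=> c).
Proof. by split; exact: measurable_cst. Qed.

Lemma cmeasurableD f g : cmeasurable f -> cmeasurable g ->
  cmeasurable (fun t => f t + g t).
Proof.
move=> [fre fim] [gre gim]; split.
  apply: eq_measurable_fun (measurable_funD fre gre) => t _ /=.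
  by case: (f t) (g t) => [? ?] [? ?].
apply: eq_measurable_fun (measurable_funD fim gim) => t _ /=.
by case: (f t) (g t) => [? ?] [? ?].
Qed.

Lemma cmeasurableM f g : cmeasurable f -> cmeasurable g ->
  cmeasurable (fun t => f t * g t).
Proof.
move=> [fre fim] [gre gim]; split.
  apply: eq_measurable_fun
    (measurable_funB (measurable_funM fre gre) (measurable_funM fim gim))
    => t _ /=.
  by case: (f t) (g t) => [? ?] [? ?].
apply: eq_measurable_fun
  (measurable_funD (measurable_funM fre gim) (measurable_funM fim gre))
  => t _ /=.
by case: (f t) (g t) => [? ?] [? ?].
Qed.

Lemma cmeasurable_sum (I : Type) (s : seq I) (F : I -> T -> R[i]) :
  (forall i, cmeasurable (F i)) -> cmeasurable (fun t => \sum_(i <- s) F i t).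
Proof.
move=> mF; elim: s => [|i s IH].
  under [X in cmeasurable X]eq_fun do rewrite big_nil.
  exact: cmeasurable_cst.
under [X in cmeasurable X]eq_fun do rewrite big_cons.
exact: cmeasurableD.
Qed.

Lemma cmeasurable_prod (I : Type) (s : seq I) (F : I -> T -> R[i]) :
  (forall i, cmeasurable (F i)) -> cmeasurable (fun t => \prod_(i <- s) F i t).
Proof.
move=> mF; elim: s => [|i s IH].
  under [X in cmeasurable X]eq_fun do rewrite big_nil.
  exact: cmeasurable_cst.
under [X in cmeasurable X]eq_fun do rewrite big_cons.
exact: cmeasurableM.
Qed.

Lemma cmeasurable_cvg (F : nat -> T -> R[i]) f :
  (forall n, cmeasurable (F n)) ->
  (forall t, D t -> F ^~ t @ \oo --> f t) -> cmeasurable f.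
Proof.
move=> mF Ff; split.
  apply: (@measurable_fun_cvg _ _ _ _ (fun n t => complex.Re (F n t))).
    by move=> n; have [] := mF n.
  by move=> t /Ff /cvgc_Re.
apply: (@measurable_fun_cvg _ _ _ _ (fun n t => complex.Im (F n t))).
  by move=> n; have [] := mF n.
by move=> t /Ff /cvgc_Im.
Qed.

Lemma measurable_cnorm_lt f (e : R) : measurable D -> cmeasurable f -> 0 < e ->
  measurable (D `&` [set t | `|f t| < e%:C%C]).
Proof.
move=> mD [re im] e0.
pose sqn t := complex.Re (f t) * complex.Re (f t) +
  complex.Im (f t) * complex.Im (f t).
have mlt : measurable_fun D (fun t => sqn t < e ^+ 2).
  apply: measurable_fun_ltr; last exact: measurable_cst.
  by apply: measurable_funD; exact: measurable_funM.
have := mlt mD [set true] I; congr (measurable _); apply/seteqP.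
split=> t [Dt ft]; split=> //; move: ft; rewrite /= /sqn -!expr2.
  rewrite -ltcR add_Re2_Im2 rmorphXn ltr_pXn2r ?nnegrE ?normr_ge0 //.
  by rewrite lecR ltW.
move=> ft; apply/idP; rewrite -ltcR add_Re2_Im2 rmorphXn ltr_pXn2r ?nnegrE //.
by rewrite lecR ltW.
Qed.

(** Finite sets of indices are enumerated by their codes, which turns the
    criterion into countable intersections and unions. *)
Lemma measurable_prod_cauchy (z : nat -> T -> R[i]) : measurable D ->
  (forall n, cmeasurable (z n)) ->
  measurable (D `&` [set t | prod_cauchy (z ^~ t)]).
Proof.
move=> mD mz.
pose A (k : nat) (s : seq nat) :=
  D `&` [set t | `|\prod_(i <- s) z i t - 1| < (k.+1%:R^-1 : R)%:C%C].
have mA k s : measurable (A k s).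
  apply: measurable_cnorm_lt => //.
  by apply: cmeasurableD (cmeasurable_cst _); exact: cmeasurable_prod.
(* Codes of no list, or of an irrelevant one, impose no condition beyond [D]. *)
pose B k N m := if unpickle m is Some s then
  if uniq s && all (leq N) s then A k s else D else D.
have mB k N m : measurable (B k N m).
  by rewrite /B; case: unpickle => // s; case: ifP.
suff -> : D `&` [set t | prod_cauchy (z ^~ t)] =
    \bigcap_k \bigcup_N \bigcap_m B k N m.
  by apply: bigcapT_measurable => k; apply: bigcupT_measurable => N;
     apply: bigcapT_measurable => m.
have kE k : ((k.+1%:R^-1 : R)%:C%C) = k.+1%:R^-1 :> R[i].
  by rewrite fmorphV rmorph_nat.
apply/seteqP; split=> t.
  move=> [Dt tC] k _; have [|N tN] := tC ((k.+1%:R^-1 : R)%:C%C).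
    by rewrite ltcR invr_gt0.
  exists N => // m _; rewrite /B; case: unpickle => // s.
  by case: ifP => // /andP[us sN]; split=> //; exact: tN.
move=> tB; have Dt : D t.
  have [N _ /(_ (pickle ([::] : seq nat)) I)] := tB 0%N I.
  by rewrite /B pickleK /= => -[].
split=> // e /invSn_ltc[k ke]; have [N _ tN] := tB k I.
exists N => s us sN; have := tN (pickle s) I.
by rewrite /B pickleK us sN /A /= kE => -[_ /lt_trans]; apply.
Qed.

Lemma cmeasurable_qprod (z : nat -> T -> R[i]) :
  (forall n, cmeasurable (z n)) -> cmeasurable (fun t => qprod (z ^~ t)).
Proof.
move=> mz; apply: cmeasurable_dom => mD.
have mC := measurable_prod_cauchy mD mz.
apply: (@cmeasurable_cvg (fun N t =>
    if `[< prod_cauchy (z ^~ t) >] then \prod_(0 <= i < N) z i t else 0));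
  last by move=> t _; exact: qprod_cvg.
move=> N.
apply: (@eq_cmeasurable (fun t =>
    (\1_(D `&` [set t | prod_cauchy (z ^~ t)]) t)%:C%C *
      \prod_(0 <= i < N) z i t)).
  move=> t Dt; rewrite indicE; case: asboolP => tC.
    by rewrite mem_set ?mul1r.
  by rewrite memNset ?mul0r // => -[].
apply: cmeasurableM; last exact: cmeasurable_prod.
split=> /=; last exact: measurable_cst.
exact: measurable_indic.
Qed.

End ComplexMeasurable.

(** * Inner products in Hilbert spaces *)

Section HilbertSpaces.
Context {R : realType} {V : hilbertType R}.
Implicit Types x y : V.

Lemma dotpDl x1 x2 y : dotp (x1 + x2) y = dotp x1 y + dotp x2 y.
Proof. by rewrite linearDl. Qed.

Lemma dotpDr x y1 y2 : dotp x (y1 + y2) = dotp x y1 + dotp x y2.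
Proof. by rewrite linearD. Qed.

Lemma dotpZl (a : R[i]) x y : dotp (a *: x) y = a * dotp x y.
Proof. by rewrite linearZl_LR. Qed.

Lemma dotpZr (a : R[i]) x y : dotp x (a *: y) = Num.conj a * dotp x y.
Proof. by rewrite linearZr_LR. Qed.

Lemma dotp_suml m (c : 'I_m -> R[i]) (x : 'I_m -> V) y :
  dotp (\sum_(i < m) c i *: x i) y = \sum_(i < m) c i * dotp (x i) y.
Proof.
rewrite linear_sumlz; apply: eq_bigr => i _; exact: dotpZl.
Qed.

Lemma dotp_sumr m (c : 'I_m -> R[i]) x (y : 'I_m -> V) :
  dotp x (\sum_(i < m) c i *: y i) = \sum_(i < m) Num.conj (c i) * dotp x (y i).
Proof.
by rewrite linear_sumr; apply: eq_bigr => i _; exact: dotpZr.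
Qed.

Lemma sqr_norm_addZ (a : R[i]) x y : `|x + a *: y| ^+ 2 =
  dotp x x + Num.conj a * dotp x y + a * dotp y x + a * Num.conj a * dotp y y.
Proof. by rewrite normr_dotp dotpDl !dotpDr !dotpZl !dotpZr mulrA -!addrA. Qed.

(** Expressing the inner product by norms reduces its joint continuity to that
    of the norm. *)
Lemma dotp_polarization x y :
  4 * dotp x y = `|x + 1 *: y| ^+ 2 - `|x + (-1) *: y| ^+ 2
    + 'i * (`|x + 'i *: y| ^+ 2 - `|x + (- 'i) *: y| ^+ 2).
Proof.
have conj1 : Num.conj 1 = 1 :> R[i] by rewrite rmorph1.
have conjN (a : R[i]) : Num.conj (- a) = - Num.conj a by rewrite rmorphN.
rewrite !sqr_norm_addZ !conjN conj1 conjCi.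
have ii : 'i * 'i = -1 :> R[i] by rewrite -expr2 sqrCi.
move: (dotp x y) (dotp y x) (dotp x x) (dotp y y) => p q r s.
move: ('i : R[i]) ii => j ii.
(* Adding a multiple of [1 + j * j], which is 0, makes the identity hold with
   [j] an indeterminate. *)
have -> : 4 * p = (2 + 2) * p - 2 * (1 + j * j) * (p - q) by rewrite ii; ring.
ring.
Qed.

Lemma cvg_dotp (u v : nat -> V) x y : u @ \oo --> x -> v @ \oo --> y ->
  (fun n => dotp (u n) (v n)) @ \oo --> dotp x y.
Proof.
move=> ux vy.
have sq_cvg (a : R[i]) :
    (fun n => `|u n + a *: v n| ^+ 2) @ \oo --> `|x + a *: y| ^+ 2.
  have ua : (fun n => u n + a *: v n) @ \oo --> x + a *: y.
    by apply: cvgD => //; exact: cvgZr.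
  rewrite expr2; under eq_fun do rewrite expr2.
  by apply: cvgM; exact: cvg_norm.
have dE (a b : V) : dotp a b = 4^-1 *
    (`|a + 1 *: b| ^+ 2 - `|a + (-1) *: b| ^+ 2
     + 'i * (`|a + 'i *: b| ^+ 2 - `|a + (- 'i) *: b| ^+ 2)) :> R[i].
  by rewrite -dotp_polarization mulrA mulVf ?mul1r // pnatr_eq0.
rewrite dE; under eq_fun do rewrite dE.
apply: cvgMr; apply: cvgD; first by apply: cvgB; exact: sq_cvg.
by apply: cvgMr; apply: cvgB; exact: sq_cvg.
Qed.

Lemma dense_cvg (S : set V) x : dense S ->
  exists u : nat -> V, (forall n, S (u n)) /\ u @ \oo --> x.
Proof.
move=> dS.
have /choice[u uP] : forall n, exists y, S y /\ `|x - y| < n.+1%:R^-1.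
  move=> n; have n0 : (0 : R[i]) < n.+1%:R^-1 by rewrite invr_gt0.
  have [||y [/interior_subset xy Sy]] := dS (ball x n.+1%:R^-1)°.
  - by exists x; exact: nbhsx_ballx.
  - exact: open_interior.
  by exists y; split=> //; rewrite -ball_normE in xy.
exists u; split=> [n|]; first by have [] := uP n.
apply/cvgrPdist_lt => e /invSn_ltc[k ke]; exists k => // n /= kn.
have [_ xn] := uP n; apply: lt_trans xn _; apply: le_lt_trans ke.
by rewrite lef_pV2 ?posrE // ler_nat ltnS.
Qed.

End HilbertSpaces.

(** * Elementary tensors and their span *)

Section CompleteTensorProducts.
Context {R : realType} {H : nat -> hilbertType R} (K : completeTensor H).

Lemma tensor_span_elementary (h : Cseq H) : tensor_span (elementary_tensor h).
Proof.
exists 1%N, (fun=> 1), (fun=> h); apply/funext => f.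
by rewrite big_ord_recl big_ord0 addr0 mul1r.
Qed.

(** The empty combination: ['I_0] being empty, any function on it will do. *)
Lemma tensor_span0 : @tensor_span R H (fun=> 0).
Proof.
exists 0%N, (fun=> 0), (fun i : 'I_0 => False_rect _ (notF (ltn_ord i))).
by apply/funext => f; rewrite big_ord0.
Qed.

(** [ct_linear] only speaks of combinations [a F + G]; that 0 is sent to 0
    follows by taking [a = 1] and [F = G = 0]. *)
Lemma ct_emb0 : ct_emb K (fun=> 0) = 0.
Proof.
have := ct_linear K 1 tensor_span0 tensor_span0.
under [X in ct_emb K X]eq_fun do rewrite mulr0 addr0.
by rewrite scale1r => /(canLR (addrK _)); rewrite subrr.
Qed.

Lemma ct_emb_sum m (c : 'I_m -> R[i]) (h : 'I_m -> Cseq H) :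
  ct_emb K (fun f => \sum_(i < m) c i * elementary_tensor (h i) f) =
  \sum_(i < m) c i *: ct_emb K (elementary_tensor (h i)).
Proof.
elim: m c h => [|m IH] c h.
  by rewrite big_ord0 -ct_emb0; congr ct_emb; apply/funext => f;
    rewrite big_ord0.
rewrite big_ord_recl -IH -ct_linear.
- by congr ct_emb; apply/funext => f; rewrite big_ord_recl.
- exact: tensor_span_elementary.
- by exists m, (fun i => c (lift ord0 i)), (fun i => h (lift ord0 i)).
Qed.

Lemma span_cvg (x : K) : exists u : nat -> K,
  (forall n, exists m (c : 'I_m -> R[i]) (h : 'I_m -> Cseq H),
     u n = \sum_(i < m) c i *: ct_emb K (elementary_tensor (h i)))
  /\ u @ \oo --> x.
Proof.
have [u [uS ux]] := dense_cvg x (ct_dense (c := K)).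
exists u; split=> // n; have [F [m [c [h ->]]] <-] := uS n.
by exists m, c, h; rewrite ct_emb_sum.
Qed.

End CompleteTensorProducts.

(** * Weak measurability of the tensor product *)

Theorem lemma6p14 (R : realType) (H : nat -> hilbertType R)
    (T : forall n : nat, R -> {linear H n -> H n})
    (K : completeTensor H) (TT : R -> {linear K -> K}) :
  (forall n, semigroup (T n)) ->
  (forall n, weakly_measurable (T n)) ->
  (forall t : R, 0 <= t -> is_tensor_op (fun n => T n t) (TT t)) ->
  semigroup TT ->
  nonzero_family TT ->
  weakly_measurable TT.
Proof.
move=> _ mT tensorTT _ _ x y.
pose D := [set t : R | 0 <= t].
suff : @cmeasurable _ (lebesgueType R) R D (fun t => dotp (TT t x) y) by [].
have m_elementary (h f : Cseq H) : @cmeasurable _ (lebesgueType R) R D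
    (fun t => dotp (TT t (ct_emb K (elementary_tensor h)))
                   (ct_emb K (elementary_tensor f))).
  apply: (@eq_cmeasurable _ (lebesgueType R) R D
    (fun t => qprod (fun n => dotp (T n t (h n)) (f n)))).
    move=> t Dt; have [_ /(_ h)[g gE ->]] := tensorTT t Dt.
    by rewrite ct_dotp; congr qprod; apply/funext => n; rewrite gE.
  by apply: cmeasurable_qprod => n; exact: mT.
have [u [uS ux]] := span_cvg x; have [v [vS vy]] := span_cvg y.
apply: (@cmeasurable_cvg _ (lebesgueType R) R D
  (fun k t => dotp (TT t (u k)) (v k))).
  move=> k; have [m [c [h ->]]] := uS k; have [m' [c' [f ->]]] := vS k.
  apply: (@eq_cmeasurable _ (lebesgueType R) R D (fun t => \sum_(i < m) c i *
     \sum_(j < m') Num.conj (c' j) *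
      dotp (TT t (ct_emb K (elementary_tensor (h i))))
           (ct_emb K (elementary_tensor (f j))))).
    move=> t _.
    have -> : TT t (\sum_(i < m) c i *: ct_emb K (elementary_tensor (h i))) =
        \sum_(i < m) c i *: TT t (ct_emb K (elementary_tensor (h i))).
      by rewrite linear_sum; apply: eq_bigr => i _; rewrite linearZ.
    by rewrite dotp_suml; apply: eq_bigr => i _; rewrite dotp_sumr.
  apply: cmeasurable_sum => i; apply: cmeasurableM (cmeasurable_cst _ _) _.
  apply: cmeasurable_sum => j; apply: cmeasurableM (cmeasurable_cst _ _) _.
  exact: m_elementary.
move=> t Dt; have [bTT _] := tensorTT t Dt.
have TTu : (fun k => TT t (u k)) @ \oo --> TT t x.
  have TTc : {for x, continuous (TT t)} by exact: bounded_linear_continuous.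
  by apply: continuous_cvg.
exact: cvg_dotp TTu vy.
Qed.
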